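(* Let $p$ be an odd prime, $h\ge1$, $q=p^h$, and let $l>2$ be an integer. Let $d,d'$ be integers with $0<d,d'\le l-1$, $\gcd(l,d)=\gcd(l,d')=1$ and $l+d$, $l+d'$ odd. Then $BH(q,l,d)$ and $BH(q,l,d')$ are strongly isotopic if and only if $d=d'$. Moreover, the strong autotopism group of $BH(q,l,d)$ has order $4lh(q^l-1)$.
   Context: Fix a nonsquare $\beta\in\mathbb{F}_{q^{2l}}$ and a nonzero $\omega\in\mathbb{F}_{q^{2l}}$ with $\omega+\omega^{q^l}=0$. For an integer $d$ with $\gcd(l,d)=1$ and $l+d$ odd, $BH(q,l,d)$ denotes the presemifield $(\mathbb{F}_{q^{2l}},+,\ast_d)$ with $$x\ast_d y=x^{q^l}y+xy^{q^l}+\Big(\beta(x^{q^d}y+xy^{q^d})+\beta^{q^l}(x^{q^d}y+xy^{q^d})^{q^l}\Big)\omega.$$ An isotopism between presemifields $(\mathbb{F}_{p^n},+,\ast)$ and $(\mathbb{F}_{p^n},+,\ast')$ is a triple $(M,N,L)$ of $\mathbb{F}_p$-linear permutations with $L(x\ast y)=M(x)\ast'N(y)$ for all $x,y$; it is a strong isotopism if $M=N$. A strong autotopism of a presemifield is a strong isotopism from it to itself; these form a group under composition. *)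

(* Defs.v *)
From mathcomp Require Import all_boot all_order all_fingroup all_algebra all_field.

Set Implicit Arguments.
Unset Strict Implicit.
Unset Printing Implicit Defensive.

Import GRing.Theory.
Local Open Scope ring_scope.

Section Presemifields.

Variables (p : nat) (F : finFieldType).

(* The prime field acts on F through the residues a%:R; this is the scaling of
   the library's 'F_p-module structure on a ring of characteristic p, see
   Fp_linearP. The predicate is boolean so that autotopisms form a {set _}. *)
Definition Fp_linear (f : F -> F) : bool :=
  [forall a : 'F_p, forall x : F, forall y : F,
     f ((a : nat)%:R * x + y) == (a : nat)%:R * f x + f y].

Lemma Fp_linearP (charFp : p \in [pchar F]) (f : F -> F) :
  reflect (linear (f : pPrimeCharType charFp -> pPrimeCharType charFp))
          (Fp_linear f).
Proof.
apply: (iffP forallP) => [fL a x y|fL a].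
  by have /forallP/(_ x)/forallP/(_ y)/eqP := fL a.
by apply/forallP=> x; apply/forallP=> y; apply/eqP; exact: (fL a x y).
Qed.

(* Triples (M, N, L) are encoded as ((M, N), L). *)
Definition isotopism (op op' : F -> F -> F)
    (t : {perm F} * {perm F} * {perm F}) : bool :=
  let: (M, N, L) := t in
  [&& Fp_linear M, Fp_linear N, Fp_linear L &
      [forall x : F, forall y : F, L (op x y) == op' (M x) (N y)]].

Definition strong_isotopism (op op' : F -> F -> F)
    (t : {perm F} * {perm F} * {perm F}) : bool :=
  isotopism op op' t && (t.1.1 == t.1.2).

Definition strongly_isotopic (op op' : F -> F -> F) : Prop :=
  exists t, strong_isotopism op op' t.

Definition strong_autotopisms (op : F -> F -> F) :
    {set {perm F} * {perm F} * {perm F}} :=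
  [set t | strong_isotopism op op t].

Lemma Fp_linear_id : Fp_linear (1%g : {perm F}).
Proof.
by apply/forallP=> a; apply/forallP=> x; apply/forallP=> y; rewrite !perm1.
Qed.

Lemma Fp_linear_comp (s t : {perm F}) :
  Fp_linear s -> Fp_linear t -> Fp_linear (s * t)%g.
Proof.
move=> /forallP sL /forallP tL; apply/forallP=> a; apply/forallP=> x.
apply/forallP=> y; rewrite !permM.
have /forallP/(_ x)/forallP/(_ y)/eqP-> := sL a.
by have /forallP/(_ (s x))/forallP/(_ (s y)) := tL a.
Qed.

(* The product of {perm F} is composition, written left to right. *)
Lemma strong_autotopisms_group_set op : group_set (strong_autotopisms op).
Proof.
apply/group_setP; split.
  rewrite inE /strong_isotopism /= !Fp_linear_id eqxx andbT /=.
  by apply/forallP=> x; apply/forallP=> y; rewrite !perm1.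
move=> [[M N] L] [[M' N'] L']; rewrite !inE /strong_isotopism /=.
case/andP=> /and4P[ML NL LL /forallP H] /eqP eMN; subst N.
case/andP=> /and4P[ML' NL' LL' /forallP H'] /eqP eMN'; subst N'.
rewrite !Fp_linear_comp // eqxx andbT /=.
apply/forallP=> x; apply/forallP=> y; rewrite !permM.
have /forallP/(_ y)/eqP-> := H x.
by have /forallP/(_ (M y)) := H' (M x).
Qed.

Definition strong_autotopism_group op : {group {perm F} * {perm F} * {perm F}} :=
  Group (strong_autotopisms_group_set op).

End Presemifields.

Definition BH (F : finFieldType) (q l : nat) (beta omega : F) (d : nat)
    (x y : F) : F :=
  let u := x ^+ (q ^ d) * y + x * y ^+ (q ^ d) in
  x ^+ (q ^ l) * y + x * y ^+ (q ^ l)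
    + (beta * u + beta ^+ (q ^ l) * u ^+ (q ^ l)) * omega.

(* Main.v *)
From HB Require Import structures.
Require Import Defs.
From mathcomp Require Import all_boot all_order all_fingroup all_algebra all_field.
From mathcomp Require Import all_solvable ring zify.

Set Implicit Arguments.
Unset Strict Implicit.
Unset Printing Implicit Defensive.

Import GRing.Theory.
Local Open Scope ring_scope.

(* Let n = 2lh and Q = q^d. Every F_p-linear map of F is uniquely a linearized
   polynomial \sum_i m_i x^(p^i) with i modulo n, and bilinear maps likewise have
   unique coefficients on the monomials x^(p^i) y^(p^j). In L (x *_d y) only the
   monomials with i - j = lh or i - j = +-dh occur. Applied to the trace part
   Tr(conj(M x) M y) of M x *_d' M y, this says that the support S of M is disjoint
   from S + lh and that two distinct elements of S differ by +-(l+d)h, so S has at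
   most two elements. The part Tr(beta (M x)^Q' M y) then forces d' = d and S = {i},
   so that M x = a x^(p^i). Such an M is an autotopism iff beta a^(Q+1) / beta^(p^i)
   lies in F_{q^l}; as gcd(q^d + 1, q^l + 1) = 2, exactly 2(q^l - 1) values of a
   qualify for each of the n values of i, and M determines L. *)

(* The proof of [p \in [pchar F]] is an argument so that [frob chF k] can carry a
   canonical ring morphism structure. *)
Definition frob (p : nat) (F : finFieldType) of p \in [pchar F] :=
  fun (k : nat) (x : F) => x ^+ (p ^ k).

(** * Powers of the Frobenius map as ring morphisms *)

Section Frobenius.

Variables (p : nat) (F : finFieldType) (chF : p \in [pchar F]).
Local Notation frob := (frob chF).

Fact frob_is_zmod_morphism k : zmod_morphism (frob k).
Proof.
elim: k => [|k IH] x y; first by rewrite /frob !expr1.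
have frobS z : frob k.+1 z = pFrobenius_aut chF (frob k z).
  by rewrite pFrobenius_autE /frob -exprM -expnSr.
by rewrite !frobS IH rmorphB.
Qed.

Fact frob_is_monoid_morphism k : monoid_morphism (frob k).
Proof. by split=> [|x y]; rewrite /frob ?expr1n ?exprMn. Qed.

HB.instance Definition _ k :=
  GRing.isZmodMorphism.Build F F (frob k) (frob_is_zmod_morphism k).
HB.instance Definition _ k :=
  GRing.isMonoidMorphism.Build F F (frob k) (frob_is_monoid_morphism k).

Lemma frobD i j x : frob (i + j) x = frob i (frob j x).
Proof. by rewrite /frob -exprM expnD mulnC. Qed.

Lemma Fp_linear_frob k : Fp_linear p (frob k).
Proof.
apply/forallP=> a; apply/forallP=> x; apply/forallP=> y.
by rewrite rmorphD rmorphM rmorph_nat.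
Qed.

End Frobenius.

(** * Linearized polynomials and F_p-linear maps *)

Section LinearizedPolynomials.

Variables (p N : nat) (F : finFieldType) (chF : p \in [pchar F]).
Hypothesis cardF : #|F| = (p ^ N.+2)%N.
Local Notation frob := (frob chF).
(** As x^(p^n) = x for n = [N.+2], exponents of Frobenius count only modulo n; the form [N.+2] makes
    [I] a nonzero ring, so indices add cyclically and numerals cast into it. *)
Local Notation I := 'I_N.+2.

Lemma frob_mod k x : frob (k %% N.+2) x = frob k x.
Proof.
rewrite [in RHS](divn_eq k N.+2) addnC frobD; congr (frob _ _).
elim: (k %/ _)%N => [|j IH]; first by rewrite mul0n /frob expn0 expr1.
by rewrite mulSn frobD -IH /frob -cardF expf_card.
Qed.

Lemma frob_ordD (i j : I) x : frob (i + j)%R x = frob i (frob j x).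
Proof. by rewrite -frobD -[RHS]frob_mod. Qed.

Lemma frob_natr k x : frob (k%:R : I) x = frob k x.
Proof. by rewrite [X in frob X _](@val_Zp_nat N.+2) // frob_mod. Qed.

(** The polynomial has degree at most p^(n-1), but all p^n elements of F are roots. *)
Lemma linpoly_eq0 (m : I -> F) :
  (forall x, \sum_i m i * frob i x = 0) -> forall i, m i = 0.
Proof.
have p_gt1 : (1 < p)%N := prime_gt1 (pcharf_prime chF).
move=> m0 i; pose P : {poly F} := \sum_j m j *: 'X^(p ^ j).
have P0 : P = 0.
  apply: (@roots_geq_poly_eq0 _ _ (enum F)); last 2 first.
  - exact: enum_uniq.
  - rewrite -cardE cardF; apply: (leq_trans (size_sum _ _ _)).
    apply/bigmax_leqP=> j _; rewrite (leq_trans (size_scale_leq _ _)) //.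
    by rewrite size_polyXn ltn_exp2l.
  apply/allP=> x _; rewrite /root /P horner_sum -[X in _ == X](m0 x).
  by apply/eqP/eq_bigr=> j _; rewrite !hornerE.
have := coef0 F (p ^ i); rewrite -P0 /P coef_sum (bigD1 i) //=.
rewrite big1 => [|j neq_ji]; rewrite coefZ coefXn ?eqxx ?mulr1 ?addr0 //.
by rewrite eqn_exp2l // eq_sym (inj_eq val_inj) (negPf neq_ji) mulr0.
Qed.

Lemma bilinpoly_eq0 (A : I -> I -> F) :
  (forall x y, \sum_i \sum_j A i j * (frob i x * frob j y) = 0) ->
  forall i j, A i j = 0.
Proof.
move=> A0 i; apply: linpoly_eq0 => y; move: i; apply: linpoly_eq0 => x.
rewrite -[RHS](A0 x y); apply: eq_bigr => i _.
by rewrite mulr_suml; apply: eq_bigr => j _; rewrite mulrAC mulrA.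
Qed.

(** Both sides are F_p-linear, so they need only agree on a basis; this is a square linear system
    for the coefficients. *)
Lemma Fp_linear_repr (f : F -> F) :
  Fp_linear p f -> exists m : I -> F, forall x, f x = \sum_i m i * frob i x.
Proof.
move=> fL; pose V := pPrimeCharType chF; pose fV : V -> V := f.
pose e := vbasis {: V}.
have dimV : \dim {: V} = N.+2.
  by rewrite pprimeChar_dimf cardF pfactorK // (pcharf_prime chF).
have linE (g : V -> V) : Fp_linear p g ->
    forall x : V, g x = \sum_j coord e j x *: g e`_j.
  move=> /(Fp_linearP chF) gL x.
  pose G : {linear V -> V} := HB.pack g (GRing.isLinear.Build _ _ _ _ g gL).
  rewrite {1}(coord_vbasis (memvf x)) -[g]/(G : V -> V) linear_sum.
  by apply: eq_bigr => j _; rewrite linearZ.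
(* The Moore matrix of the basis [e] is invertible, because a linearized
   polynomial vanishing on [e] vanishes on F. *)
pose A : 'M[F]_(N.+2, \dim {:V}) := \matrix_(i, j) frob i (e`_j : F).
have evalE (v : 'rV_N.+2) (x : V) : \sum_i v 0 i * frob i x
    = \sum_j ((coord e j x : 'F_p) : nat)%:R * (v *m A) 0 j.
  transitivity (\sum_i \sum_j
      v 0 i * (((coord e j x : 'F_p) : nat)%:R * frob i (e`_j : F))).
    apply: eq_bigr => i _; rewrite (linE _ (Fp_linear_frob chF i)) mulr_sumr.
    by apply: eq_bigr => j _.
  rewrite exchange_big; apply: eq_bigr => j _; rewrite mxE mulr_sumr.
  by apply: eq_bigr => i _; rewrite mxE mulrCA.
have Afree : row_free A.
  apply/inj_row_free => v vA; apply/rowP=> i; rewrite mxE; move: i.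
  apply: linpoly_eq0 => x; rewrite (evalE v x) big1 // => j _.
  by rewrite vA mxE mulr0.
have /row_fullP[B BA] : row_full A by rewrite /row_full (eqP Afree) dimV.
exists (fun i => ((\row_j (f (e`_j : F))) *m B) 0 i) => x.
rewrite (evalE _ x) (linE f fL) -mulmxA BA mulmx1.
by apply: eq_bigr => j _; rewrite mxE.
Qed.

End LinearizedPolynomials.

(** * Coefficients of bilinear polynomials *)

Section BilinearForms.

Variables (p N : nat) (F : finFieldType) (chF : p \in [pchar F]).
Hypothesis cardF : #|F| = (p ^ N.+2)%N.
Local Notation frob := (frob chF).
Local Notation I := 'I_N.+2.

Definition bilinpoly (A : I -> I -> F) (x y : F) :=
  \sum_i \sum_j A i j * (frob i x * frob j y).

Lemma bilinpolyD A B x y :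
  bilinpoly A x y + bilinpoly B x y = bilinpoly (fun i j => A i j + B i j) x y.
Proof.
rewrite -big_split; apply: eq_bigr => i _; rewrite -big_split.
by apply: eq_bigr => j _; rewrite mulrDl.
Qed.

Lemma bilinpolyZ c A x y :
  c * bilinpoly A x y = bilinpoly (fun i j => c * A i j) x y.
Proof.
rewrite mulr_sumr; apply: eq_bigr => i _; rewrite mulr_sumr.
by apply: eq_bigr => j _; rewrite mulrA.
Qed.

Lemma bilinpoly_inj A B :
  bilinpoly A =2 bilinpoly B -> forall i j, A i j = B i j.
Proof.
move=> AB i j; apply/eqP; rewrite -subr_eq0; apply/eqP.
move: i j; apply: (bilinpoly_eq0 cardF) => x y.
transitivity (bilinpoly A x y + -1 * bilinpoly B x y).
  rewrite bilinpolyZ bilinpolyD; apply: eq_bigr => i _; apply: eq_bigr => j _.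
  by rewrite mulN1r.
by rewrite AB mulN1r subrr.
Qed.

Lemma linpolyM (a b : I -> F) x y :
  (\sum_i a i * frob i x) * (\sum_j b j * frob j y)
  = bilinpoly (fun i j => a i * b j) x y.
Proof.
rewrite mulr_suml; apply: eq_bigr => i _; rewrite mulr_sumr.
by apply: eq_bigr => j _; rewrite mulrACA.
Qed.

Lemma frob_linpoly (k : I) (m : I -> F) x :
  frob k (\sum_i m i * frob i x) = \sum_i frob k (m (i - k)) * frob i x.
Proof.
rewrite rmorph_sum [RHS](reindex_inj (addIr k)); apply: eq_bigr => i _.
by rewrite addrK rmorphM [(i + k)%R]addrC (frob_ordD chF cardF).
Qed.

(** A linearized polynomial applied to one product of Frobenius powers of x and y gives such a sum;
    its monomials lie on the diagonal i - j = a - b, selected by the Boolean multiple. *)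
Lemma bilinpoly_diag (c : I -> F) (a b : I) x y :
  \sum_k c k * (frob (k + a)%R x * frob (k + b)%R y)
  = bilinpoly (fun i j => c (i - a) *+ (i - a == j - b)) x y.
Proof.
rewrite /bilinpoly [RHS](reindex_inj (addIr a)); apply: eq_bigr => k _.
rewrite (bigD1 (k + b)) //= !addrK eqxx big1 ?addr0 ?mulr1n // => j.
by rewrite -subr_eq eq_sym => /negPf->; rewrite mulr0n mul0r.
Qed.

End BilinearForms.

(** * The product of BH in terms of Frobenius indices *)

Section FormOfIsotopisms.

Variables (p N : nat) (F : finFieldType) (chF : p \in [pchar F]).
Hypothesis cardF : #|F| = (p ^ N.+2)%N.
Local Notation frob := (frob chF).
Local Notation I := 'I_N.+2.
Local Notation bilinpoly := (bilinpoly chF).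

Variables (s : I) (beta omega : F).
Hypotheses (s_neq0 : s != 0) (ss : s + s = 0).
Hypotheses (beta_neq0 : beta != 0) (omega_neq0 : omega != 0).
Hypothesis omega_conj : frob s omega = - omega.
Hypothesis two_neq0 : (2%:R : F) != 0.

Definition cross (delta : I) (x y : F) := frob delta x * y + x * frob delta y.

(* [BH] with the conjugation x |-> x^(q^l) written [frob s] and x^(q^d) written
   [frob delta]. *)
Definition bh (delta : I) (x y : F) :=
  cross s x y + (beta * cross delta x y
    + frob s beta * frob s (cross delta x y)) * omega.

Lemma frobC j k x : frob j (frob k x) = frob k (frob j x).
Proof. by rewrite -!frobD addnC. Qed.

Lemma frob_ss x : frob s (frob s x) = x.
Proof. by rewrite -(frob_ordD chF cardF) ss /frob expr1. Qed.

Lemma subr_s (i : I) : i - s = i + s.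
Proof. by rewrite -[LHS]addr0 -ss addrA subrK. Qed.

(** Conjugation fixes [cross s x y] and the cofactor of [omega] but negates [omega], so adding or
    subtracting the conjugate isolates one of the two trace forms. *)
Lemma bh_real delta x y :
  bh delta x y + frob s (bh delta x y) = 2%:R * cross s x y.
Proof.
rewrite /bh /cross !(rmorphD, rmorphM) /= omega_conj !frob_ss; ring.
Qed.

Lemma bh_imag delta x y :
  bh delta x y - frob s (bh delta x y)
  = (2%:R * omega) * (beta * cross delta x y
    + frob s beta * frob s (cross delta x y)).
Proof.
rewrite /bh /cross !(rmorphD, rmorphM) /= omega_conj !frob_ss; ring.
Qed.

(* The terms with [la (j + s)] come from the conjugate of beta, on which
   [omega_conj] produces the sign. *)
Definition bh_coef (delta : I) (la : I -> F) (i j : I) : F :=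
  la j *+ (i - s == j) + la i *+ (i == j - s)
  + (la j * frob j (omega * beta)) *+ (i - delta == j)
  + (la i * frob i (omega * beta)) *+ (i == j - delta)
  - (la (j + s) * frob j (omega * beta)) *+ (i - delta == j)
  - (la (i + s) * frob i (omega * beta)) *+ (i == j - delta).

Lemma linpoly_bh delta (la : I -> F) x y :
  \sum_k la k * frob k (bh delta x y) = bilinpoly (bh_coef delta la) x y.
Proof.
pose g k := la k * frob k (omega * beta).
pose g' k := la k * frob k (omega * frob s beta).
(* One pair of diagonals each for [cross s], for the term in [beta] and for its conjugate. *)
transitivity (\sum_k la k * (frob (k + s)%R x * frob (k + 0)%R y)
  + \sum_k la k * (frob (k + 0)%R x * frob (k + s)%R y)
  + \sum_k g k * (frob (k + delta)%R x * frob (k + 0)%R y)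
  + \sum_k g k * (frob (k + 0)%R x * frob (k + delta)%R y)
  + \sum_k g' k * (frob (k + (s + delta))%R x * frob (k + s)%R y)
  + \sum_k g' k * (frob (k + s)%R x * frob (k + (s + delta))%R y)).
  rewrite -!big_split; apply: eq_bigr => k _.
  rewrite /g /g' !addr0 !(frob_ordD chF cardF) /bh /cross.
  rewrite !(rmorphD, rmorphM) /=; ring.
rewrite !bilinpoly_diag // !bilinpolyD; apply: eq_bigr => i _.
apply: eq_bigr => j _; congr (_ * _); rewrite /bh_coef /g !subr0.
have g'E k : g' (k - s) = - (la (k + s) * frob k (omega * beta)).
  rewrite /g' subr_s (frob_ordD chF cardF) !rmorphM /= omega_conj frob_ss.
  by rewrite rmorphN mulNr mulrN.
have opE : (i - (s + delta) == j - s) = (i - delta == j).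
  by rewrite addrC opprD -addrA [X in _ == X]addrC (inj_eq (addrI _)) addrC.
have opE' : (i - s == j - (s + delta)) = (i == j - delta).
  rewrite addrC [X in _ == X]addrC opprD -addrA (inj_eq (addrI _)).
  by rewrite [X in _ == X]addrC.
have eqE (c : I -> F) (u v : I) : c u *+ (u == v) = c v *+ (u == v).
  by case: eqP => [->|].
rewrite [la (i - s) *+ _]eqE [g (i - delta) *+ _]eqE.
by rewrite [g' (i - (s + delta)) *+ _]eqE !g'E opE opE' !mulNrn.
Qed.


Lemma bilinpoly_bh delta (La : F -> F) (A : I -> I -> F) :
    Fp_linear p La -> (forall x y, La (bh delta x y) = bilinpoly A x y) ->
  exists2 la : I -> F, forall x, La x = \sum_k la k * frob k x
    & forall i j, A i j = bh_coef delta la i j.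
Proof.
move=> /(Fp_linear_repr chF cardF)[la laE] LaA; exists la => //.
by apply: (bilinpoly_inj cardF) => x y; rewrite -LaA laE linpoly_bh.
Qed.

Lemma opp_s : - s = s. Proof. by rewrite -[LHS]add0r subr_s add0r. Qed.

(** Three differences cover all six diagonals because [- s = s]. *)
Lemma bh_coef_supp delta la i j :
  i - j \notin [:: s; delta; - delta] -> bh_coef delta la i j = 0.
Proof.
rewrite !inE !negb_or => /and3P[ijs ijd ijNd].
have e1 c : (i - c == j) = (i - j == c) by rewrite !subr_eq addrC.
have e2 c : (i == j - c) = (i - j == - c) by rewrite subr_eq addrC.
rewrite /bh_coef !e1 !e2 opp_s (negPf ijs) (negPf ijd) (negPf ijNd).
by rewrite !mulr0n !subr0 !addr0.
Qed.

Lemma bh_coef_cross_s delta la k :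
  delta != s -> bh_coef delta la (k + s) k = la k + la (k + s).
Proof.
move=> d_neqs; have ksd : (k + s == k - delta) = false.
  rewrite (inj_eq (addrI _)) -{1}opp_s (inj_eq oppr_inj) eq_sym.
  exact: negPf.
have ksd' : (k + s - delta == k) = false.
  by rewrite subr_eq (inj_eq (addrI _)) eq_sym (negPf d_neqs).
rewrite /bh_coef ksd ksd' [k + s - s]addrK [k - s]subr_s !eqxx.
by rewrite !mulr0n !subr0 !addr0.
Qed.

Lemma bh_coef_cross_delta delta la k : delta != s -> delta + delta != 0 ->
  bh_coef delta la (k + delta) k
  = (la k - la (k + s)) * frob k (omega * beta).
Proof.
move=> d_neqs dd_neq0; have kds : (k + delta == k + s) = false.
  by rewrite (inj_eq (addrI _)) (negPf d_neqs).
have kdd : (k + delta == k - delta) = false.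
  by rewrite (inj_eq (addrI _)) -subr_eq0 opprK (negPf dd_neq0).
rewrite /bh_coef subr_eq [k - s]subr_s kds kdd [k + _ - _]addrK !eqxx.
by rewrite !mulr0n !subr0 !addr0 !add0r mulrBl.
Qed.

(** The coefficients at differences [s] and [delta] give, up to a nonzero factor, the sum and the
    difference of [la k] and [la (k + s)]. As 2 is invertible, they determine [la]. *)
Lemma Fp_linear_bh_inj delta (La La' : F -> F) :
    delta != s -> delta + delta != 0 -> Fp_linear p La -> Fp_linear p La' ->
  (forall x y, La (bh delta x y) = La' (bh delta x y)) -> La =1 La'.
Proof.
move=> d_neqs dd_neq0 LaL La'L LaE.
have [la laE] := Fp_linear_repr chF cardF LaL.
have [la' la'E] := Fp_linear_repr chF cardF La'L.
have coefE i j : bh_coef delta la i j = bh_coef delta la' i j.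
  by apply: (bilinpoly_inj cardF) => x y; rewrite -!linpoly_bh -laE -la'E.
suff laE' k : la k = la' k.
  by move=> x; rewrite laE la'E; apply: eq_bigr => k _; rewrite laE'.
have := coefE (k + s) k; rewrite !bh_coef_cross_s // => sumE.
have := coefE (k + delta) k; rewrite !bh_coef_cross_delta //.
have ob0 : frob k (omega * beta) != 0 by rewrite fmorph_eq0 mulf_neq0.
move=> /(mulIf ob0) difE; apply: (mulfI two_neq0).
have -> : 2%:R * la k = (la k + la (k + s)) + (la k - la (k + s)) by ring.
by rewrite sumE difE; ring.
Qed.

Lemma cross_linpoly (k : I) (m : I -> F) x y :
  cross k (\sum_i m i * frob i x) (\sum_i m i * frob i y)
  = bilinpoly
      (fun i j => frob k (m (i - k)) * m j + m i * frob k (m (j - k))) x y.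
Proof. by rewrite /cross !frob_linpoly // !linpolyM bilinpolyD. Qed.

Lemma frob_bilinpoly (k : I) A x y :
  frob k (bilinpoly A x y)
  = bilinpoly (fun i j => frob k (A (i - k) (j - k))) x y.
Proof.
rewrite /bilinpoly rmorph_sum [RHS](reindex_inj (addIr k)).
apply: eq_bigr => i _; rewrite rmorph_sum [RHS](reindex_inj (addIr k)).
apply: eq_bigr => j _; rewrite !addrK !rmorphM.
by rewrite [(i + k)%R]addrC [(j + k)%R]addrC !(frob_ordD chF cardF).
Qed.

(** * The first component of a strong isotopism is a monomial *)

Section Monomial.

Variables (delta delta' : I) (m : I -> F) (L : F -> F).
Let M x := \sum_i m i * frob i x.
Hypothesis L_lin : Fp_linear p L.
Hypothesis LM : forall x y, L (bh delta x y) = bh delta' (M x) (M y).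

(** The coefficients of [cross delta' (M x) (M y)], by [cross_linpoly]. *)
Let X i j :=
  frob delta' (m (i - delta')) * m j + m i * frob delta' (m (j - delta')).

(** Adding the conjugate to [L] keeps it F_p-linear in the product and removes the [omega] part of
    the right-hand side; what remains inherits the support of [bh_coef]. *)
Lemma real_coef_eq0 i j : i - j \notin [:: s; delta; - delta] ->
  frob s (m (i - s)) * m j + m i * frob s (m (j - s)) = 0.
Proof.
move=> ij; pose La x := L x + frob s (L x).
have LaL : Fp_linear p La.
  have /forallP LL := L_lin.
  apply/forallP=> a; apply/forallP=> x; apply/forallP=> y; rewrite /La.
  have /forallP/(_ x)/forallP/(_ y)/eqP-> := LL a.
  by rewrite rmorphD rmorphM rmorph_nat mulrDr addrACA.
have [|la _ laE] := @bilinpoly_bh delta La (fun i j =>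
  2%:R * (frob s (m (i - s)) * m j + m i * frob s (m (j - s)))) LaL.
  by move=> x y; rewrite /La LM bh_real cross_linpoly bilinpolyZ.
by apply: (mulfI two_neq0); rewrite mulr0 laE bh_coef_supp.
Qed.

(** The counterpart for the [omega] part. The values in terms of [la], beyond their support, serve
    in [isotopism_monomial_real]. *)
Lemma imag_coefE : exists la, forall i j,
  (2%:R * omega) * (beta * X i j + frob s beta * frob s (X (i - s) (j - s)))
  = bh_coef delta la i j.
Proof.
pose La x := L x - frob s (L x).
have LaL : Fp_linear p La.
  have /forallP LL := L_lin.
  apply/forallP=> a; apply/forallP=> x; apply/forallP=> y; rewrite /La.
  have /forallP/(_ x)/forallP/(_ y)/eqP-> := LL a.
  by rewrite rmorphD rmorphM rmorph_nat mulrBr opprD addrACA.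
have [|la _ laE] := @bilinpoly_bh delta La (fun i j => (2%:R * omega)
  * (beta * X i j + frob s beta * frob s (X (i - s) (j - s)))) LaL.
  move=> x y; rewrite /La LM bh_imag cross_linpoly frob_bilinpoly.
  by rewrite !bilinpolyZ bilinpolyD bilinpolyZ.
by exists la.
Qed.

Lemma imag_coef_eq0 i j : i - j \notin [:: s; delta; - delta] ->
  beta * X i j + frob s beta * frob s (X (i - s) (j - s)) = 0.
Proof.
have [la laE] := imag_coefE => ij.
apply: (mulfI (mulf_neq0 two_neq0 omega_neq0)).
by rewrite mulr0 laE bh_coef_supp.
Qed.

(** For BH these say that, modulo 2l, none of d, 2d, l + 2d, l + 3d is 0 and d is not l. *)
Hypotheses (d_neq0 : delta != 0) (dd_neq0 : delta + delta != 0).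
Hypotheses (d_neqs : delta != s) (sdd_neq0 : s + (delta + delta) != 0).
Hypotheses (sddd_neq0 : s + (delta + (delta + delta)) != 0).

Lemma zero_notin_cross_support : 0 \notin [:: s; delta; - delta].
Proof.
by rewrite !inE !negb_or eq_sym s_neq0 eq_sym d_neq0 eq_sym oppr_eq0.
Qed.

(** At (i, i), outside the support, both terms of the real part coincide and give 2 [m i] times the
    conjugate of [m (i + s)]. *)
Lemma coef_shift_eq0 i : m i != 0 -> m (i + s) = 0.
Proof.
move=> mi; have := @real_coef_eq0 i i.
rewrite subrr => /(_ zero_notin_cross_support).
rewrite mulrC -mulr2n -mulr_natl => /eqP; rewrite !mulf_eq0.
by rewrite (negPf two_neq0) (negPf mi) fmorph_eq0 subr_s => /eqP.
Qed.

Local Notation e := (s + delta).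

(** At (i, j + s) only [m i] times the conjugate of [m j] survives, so i - j - s must be one of the
    three supported differences. *)
Lemma coef_diff i j : m i != 0 -> m j != 0 -> i - j \in [:: 0; e; - e].
Proof.
move=> mi mj; apply/negPn/negP=> ij; have := @real_coef_eq0 i (j + s).
rewrite subr_s (coef_shift_eq0 mi) rmorph0 mul0r add0r addrK.
suff ijs : i - (j + s) \notin [:: s; delta; - delta].
  move=> /(_ ijs)/eqP; rewrite mulf_eq0 fmorph_eq0.
  by rewrite (negPf mi) (negPf mj).
apply: contra ij; rewrite !inE opprD addrA !subr_eq ss opprD opp_s.
by rewrite [s - _]addrC [s + _]addrC.
Qed.

Lemma coef_base : (exists i, m i != 0) ->
  exists2 i, m i != 0 & forall j, m j != 0 -> j = i \/ j = i + e.
Proof.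
case=> i mi; case: (eqVneq (m (i - e)) 0) => [mie|mie].
  exists i => // j mj; have := coef_diff mj mi; rewrite !inE !subr_eq add0r.
  case/or3P=> /eqP jE; [by left | by right; rewrite jE addrC |].
  by rewrite jE addrC mie eqxx in mj.
(* Here i + e is impossible: its difference from i - e is 2e = 2[delta], which is none of 0, e,
   -e. *)
exists (i - e) => // j mj; rewrite subrK.
have := coef_diff mj mi; rewrite !inE !subr_eq add0r.
case/or3P=> /eqP jE; [by right | | by left; rewrite jE addrC].
have := coef_diff mj mie; rewrite jE opprB addrACA subrr addr0.
have -> : e + e = delta + delta by rewrite addrACA ss add0r.
rewrite !inE (negPf dd_neq0) (inj_eq (addIr _)) (negPf d_neqs) -addr_eq0.
by rewrite addrCA -addrA (negPf sddd_neq0).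
Qed.

Hypotheses (d'_neq0 : delta' != 0) (d'_neqs : delta' != s).
Hypotheses (d'_neqsd : delta' != s + delta) (d'_neqNd : delta' != - delta).

Lemma isotopism_monomial : (exists i, m i != 0) ->
  delta' = delta /\ exists2 i, m i != 0 & forall j, j != i -> m j = 0.
Proof.
move=> /coef_base[i mi supp].
have m0 j : j - i != 0 -> j - i != e -> m j = 0.
  rewrite !subr_eq add0r => ji jie; apply/eqP/negPn/negP=> /supp[] jE.
    by rewrite jE eqxx in ji.
  by rewrite jE addrC eqxx in jie.
have misd' : m (i - s) = 0 by rewrite subr_s coef_shift_eq0.
(* Otherwise (i + delta', i) is outside the support, while its entry reduces to [beta] times a
   nonzero product of Frobenius powers of [m i]. *)
have neqd : delta' = delta.
  apply/eqP/negPn/negP=> d'_neqd.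
  have := @imag_coef_eq0 (i + delta') i; rewrite addrAC subrr add0r.
  rewrite !inE !negb_or d'_neqs d'_neqd d'_neqNd => /(_ isT) /eqP.
  rewrite /X addrK (m0 (i + delta')) ?mul0r ?addr0; last 2 first.
  - by rewrite addrAC subrr add0r.
  - by rewrite addrAC subrr add0r.
  rewrite misd' mulr0 add0r (m0 (i + delta' - s)) ?mul0r ?rmorph0 ?mulr0 ?addr0.
  - by rewrite !mulf_eq0 fmorph_eq0 (negPf beta_neq0) (negPf mi).
  - by rewrite addrAC [i + _]addrC addrK subr_eq0.
  - rewrite addrAC [i + _]addrC addrK subr_s addrC (inj_eq (addrI _)).
    exact: d'_neqd.
split=> //; exists i => // j ji.
case: (eqVneq (m j) 0) => // mj; case: (supp j mj) => jE.
  by rewrite jE eqxx in ji.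
(* If [m (i + e)] is also nonzero, the entry at (i + e + delta, i) reduces to a nonzero product
   involving [m i] and [m (i + e)], yet this position is outside the support. *)
have Xz : e + delta \notin [:: s; delta; - delta].
  rewrite !inE !negb_or -addr_eq0 -!addrA sddd_neq0 andbT.
  rewrite -[X in _ == X]addr0 (inj_eq (addrI _)) dd_neq0 /=.
  rewrite addrA -[X in _ == X]add0r (inj_eq (addIr _)) addrC -subr_s subr_eq0.
  exact: d_neqs.
have := @imag_coef_eq0 (i + (e + delta)) i; rewrite addrAC subrr add0r.
move=> /(_ Xz)/eqP; rewrite /X neqd misd' mulr0 add0r addrA addrK.
have mied : m (i + e + delta) = 0.
  have -> : i + e + delta = i + (s + (delta + delta)) by rewrite -!addrA.
  apply: m0; rewrite addrC addKr //.
  by rewrite (inj_eq (addrI _)) -subr_eq0 addrK.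
have mids : m (i + e + delta - s) = 0.
  have -> : i + e + delta - s = i + (delta + delta).
    by rewrite -!addrA; congr (i + _); rewrite addrC -!addrA addNr addr0.
  apply: m0; rewrite addrC addKr //.
  by rewrite (inj_eq (addIr _)).
rewrite mied mids mul0r addr0 mul0r rmorph0 mulr0 addr0 -jE.
by rewrite !mulf_eq0 fmorph_eq0 (negPf beta_neq0) (negPf mi) (negPf mj).
Qed.

(** The entries at (i + delta, i) and at its shift by [s] are two equations in the same unknown T =
    [la i - la (i + s)]; the sign from the shift cancels that of the conjugate of [omega], and
    eliminating T leaves the claim. *)
Lemma isotopism_monomial_real i : delta' = delta ->
    (forall j, j != i -> m j = 0) ->
  let z := beta * (frob delta (m i) * m i) * frob i (frob s beta) in
  frob s z = z.
Proof.
move=> neqd m0 z; have [la laE] := imag_coefE.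
have m0' t : t != 0 -> m (i + t) = 0.
  by move=> t0; apply: m0; rewrite -subr_eq0 addrAC subrr add0r.
set A := frob delta (m i) * m i in z *.
have XE : X (i + delta) i = A.
  by rewrite /X neqd addrK (m0' delta) // mul0r addr0.
have XsE : X (i + s + delta) (i + s) = 0.
  rewrite /X neqd addrK (m0' s) // mulr0 add0r -addrA m0' ?mul0r //.
  by rewrite -{1}opp_s addrC subr_eq0.
clearbody A; have := laE (i + delta) i; rewrite XE.
rewrite !subr_s addrAC XsE rmorph0 mulr0 addr0 bh_coef_cross_delta // => eq1.
have := laE (i + s + delta) (i + s); rewrite XsE mulr0 add0r.
rewrite [i + s + delta]addrAC !addrK XE [i + delta + s]addrAC.
rewrite bh_coef_cross_delta // -addrA ss addr0 => eq2.
rewrite (frob_ordD chF cardF) !rmorphM /= omega_conj rmorphN in eq2.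
rewrite rmorphM /= in eq1; set T := la i - la (i + s) in eq1.
rewrite -(opprB (la i)) -/T in eq2.
apply: (mulfI (mulf_neq0 two_neq0 omega_neq0)).
rewrite /z 2!rmorphM /= frobC frob_ss mulrA eq2 [RHS]mulrA eq1.
by ring.
Qed.

End Monomial.

(** * Admissible monomials extend to autotopisms *)

Section MonomialAutotopisms.

Variables (delta : I) (i : I) (a : F).
Local Notation A := (frob delta a * a).

(* Up to the norm of [frob i beta], the element required to be real is
   beta * a^(q^d + 1) / beta^(p^i). *)
Definition admissible : bool := (a != 0) &&
  (frob s (beta * A * frob i (frob s beta)) == beta * A * frob i (frob s beta)).

(** The factor by which the [omega] part is scaled: it matches the terms in [beta], and
    admissibility makes it match the conjugate terms too. *)
Let kappa := beta * A * omega / frob i (beta * omega).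

(** The candidate for [L]: the fixed and the negated part of z under conjugation need different
    factors, the norm of [a] and [kappa]. *)
Definition autotopism_image (z : F) :=
  (a * frob s a * frob i (z + frob s z) + kappa * frob i (z - frob s z)) / 2%:R.

Lemma autotopism_image_Fp_linear : Fp_linear p autotopism_image.
Proof.
apply/forallP=> b; apply/forallP=> x; apply/forallP=> y; apply/eqP.
rewrite /autotopism_image !(rmorphD, rmorphB, rmorphM, rmorph_nat) /=.
by field.
Qed.

Hypothesis adm : admissible.

Let a_neq0 : a != 0. Proof. by case/andP: adm. Qed.

Let betaE :
  beta * A * frob i (frob s beta) = frob s beta * frob s A * frob i beta.
Proof.
by case/andP: adm => _ /eqP <-; rewrite 2!rmorphM /= frobC frob_ss.
Qed.

Let i_neq0 c : c != 0 -> frob i c != 0. Proof. by rewrite fmorph_eq0. Qed.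
Let sa_neq0 : frob s a != 0. Proof. by rewrite fmorph_eq0. Qed.

Let kappaE : kappa * frob i omega * frob i beta = beta * A * omega.
Proof.
rewrite /kappa rmorphM /=; field.
by rewrite (i_neq0 omega_neq0) (i_neq0 beta_neq0).
Qed.

Let kappaE' : kappa * frob i omega * frob i (frob s beta)
  = frob s beta * frob s A * omega.
Proof.
apply: (mulIf (i_neq0 beta_neq0)).
rewrite mulrAC kappaE mulrAC betaE; ring.
Qed.

Lemma autotopism_imageE x y :
  autotopism_image (bh delta x y) = bh delta (a * frob i x) (a * frob i y).
Proof.
have crossE k : cross k (a * frob i x) (a * frob i y)
    = (a * frob k a) * frob i (cross k x y).
  by rewrite /cross !(rmorphD, rmorphM) /= ![frob k (frob i _)]frobC; ring.
rewrite /autotopism_image bh_real bh_imag /bh !crossE.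
apply: (mulIf two_neq0); rewrite divfK // [a * frob delta a]mulrC.
set C := cross s x y; set u := cross delta x y; clearbody C u.
rewrite [frob s (A * _)]rmorphM /= [frob s (frob i u)]frobC.
move: kappaE kappaE'; move: (frob s A) => B kE kE'.
rewrite !(rmorphD, rmorphM, rmorph_nat) /=.
transitivity (2%:R * (a * frob s a * frob i C) + 2%:R *
  ((kappa * frob i omega * frob i beta) * frob i u
   + (kappa * frob i omega * frob i (frob s beta)) * frob i (frob s u))).
  by ring.
by rewrite kE kE'; ring.
Qed.

(** Since [kappa] is fixed by conjugation, conjugating an equation with value 0 flips the sign of
    the second term only, so both parts of z vanish. *)
Lemma autotopism_image_inj : injective autotopism_image.
Proof.
have kappa_real : frob s kappa = kappa.
  apply: (mulIf (mulf_neq0 (i_neq0 omega_neq0) (i_neq0 beta_neq0))).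
  rewrite !mulrA kappaE; have := congr1 (frob s) kappaE'.
  move: (A) => B; rewrite !rmorphM /=.
  rewrite !frob_ss ![frob s (frob i _)]frobC frob_ss omega_conj rmorphN.
  by rewrite !mulrN mulNr => /oppr_inj.
have frob0 z : frob i z = 0 -> z = 0 by move/eqP; rewrite fmorph_eq0 => /eqP.
have kappa_neq0 : kappa != 0.
  by rewrite !mulf_neq0 ?invr_eq0 ?fmorph_eq0 ?mulf_neq0.
move: kappa_real kappa_neq0; rewrite /autotopism_image.
move: kappa => k k_real k_neq0; pose f z := (a * frob s a
  * frob i (z + frob s z) + k * frob i (z - frob s z)) / 2%:R.
rewrite -/f; suff ker z : f z = 0 -> z = 0.
  move=> x y xy; apply/eqP; rewrite -subr_eq0; apply/eqP/ker.
  transitivity (f x - f y); last by rewrite xy subrr.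
  by rewrite /f !(rmorphD, rmorphN) /=; ring.
move/(congr1 ( *%R^~ 2%:R)); rewrite mul0r /f divfK // => z0.
have := congr1 (frob s) z0; rewrite rmorph0 rmorphD !rmorphM /= k_real.
rewrite ![frob s (frob i _)]frobC rmorphD rmorphB !frob_ss => z0'.
have re0 : z + frob s z = 0.
  apply/frob0/(mulfI (mulf_neq0 two_neq0 (mulf_neq0 a_neq0 sa_neq0))).
  have := congr2 +%R z0 z0'; rewrite mulr0 addr0 => <-.
  by rewrite !(rmorphD, rmorphN) /= frob_ss; ring.
have im0 : z - frob s z = 0.
  apply/frob0/(mulfI k_neq0); move: z0; rewrite re0 rmorph0 mulr0 add0r.
  by rewrite mulr0.
apply: (mulfI two_neq0); have := congr2 +%R re0 im0.
by rewrite mulr0 addr0 => <-; ring.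
Qed.

End MonomialAutotopisms.

End FormOfIsotopisms.

(** * Counting admissible coefficients *)

Lemma expf_card_pred (F : finFieldType) (x : F) :
  x != 0 -> x ^+ #|F|.-1 = 1.
Proof.
move=> x_neq0; apply: (mulIf x_neq0); rewrite mul1r -exprSr.
by rewrite prednK ?expf_card // ltnW // finNzRing_gt1.
Qed.

(** The multiplicative group is cyclic, so a power of a generator is a primitive m-th root of
    unity. *)
Lemma card_unity_roots (F : finFieldType) (m : nat) :
  (0 < m)%N -> (m %| #|F|.-1)%N -> #|[set a : F | a ^+ m == 1]| = m.
Proof.
move=> m_gt0 m_dvd.
have n_gt0 : (0 < #|F|.-1)%N by rewrite -subn1 subn_gt0 finNzRing_gt1.
have /hasP[g _ g_prim] :
    has #|F|.-1.-primitive_root [seq x <- enum F | x != 0].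
  apply: has_prim_root => //; last first.
  - rewrite -(cardC1 (0 : F)) cardE.
    apply: uniq_leq_size => [|x]; first exact: enum_uniq.
    by rewrite mem_enum inE mem_filter mem_enum andbT.
  - by rewrite filter_uniq ?enum_uniq.
  by apply/allP=> x; rewrite mem_filter unity_rootE => /andP[/expf_card_pred->].
have z_prim := dvdn_prim_root g_prim m_dvd; set z := g ^+ _ in z_prim.
have -> : [set a : F | a ^+ m == 1] = [set z ^+ i | i : 'I_m].
  apply/setP=> a; rewrite inE; apply/eqP/imsetP => [am|[i _ ->]].
    by have [i ->] := prim_rootP z_prim am; exists i.
  by rewrite -exprM mulnC exprM (prim_expr_order z_prim) expr1n.
rewrite card_imset ?card_ord // => i j /eqP; rewrite (eq_prim_root_expr z_prim).
by rewrite !modn_small // => /eqP/val_inj.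
Qed.

(** Modulo the gcd G, both q^(2d) and q^(2l) are 1, hence q^2 = 1 by Bezout. One of l, d is even,
    and for it q^k + 1 = 2 modulo G. *)
Lemma gcdn_expn_add1 (q l d : nat) :
    (0 < d)%N -> odd q -> gcdn l d = 1%N -> odd (l + d) ->
  gcdn (q ^ d + 1) (q ^ l + 1) = 2%N.
Proof.
move=> d_gt0 q_odd gcd_ld odd_ld; set G := gcdn _ _.
have q_gt0 : (0 < q)%N by case: q q_odd @G.
have Gd : (G %| q ^ d + 1)%N by apply: dvdn_gcdl.
have Gl : (G %| q ^ l + 1)%N by apply: dvdn_gcdr.
have sqr1 k : (G %| q ^ k + 1)%N -> q ^ (2 * k) = 1 %[mod G].
  move=> Gk; apply/eqP; rewrite eqn_mod_dvd ?expn_gt0 ?q_gt0 //.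
  have -> : (q ^ (2 * k) - 1 = (q ^ k - 1) * (q ^ k + 1))%N.
    by rewrite mulnC expnM -[1%N in LHS](exp1n 2) subn_sqr.
  by rewrite dvdn_mull.
have mod_exp1 a k : a = 1 %[mod G] -> (a ^ k = 1 %[mod G])%N.
  by move=> a1; rewrite -modnXm a1 modnXm exp1n.
have q2 : q ^ 2 = 1 %[mod G].
  case: (egcdnP l d_gt0) => kd kl; rewrite gcdnC gcd_ld => E _.
  have Ed : q ^ (2 * (kd * d)) = 1 %[mod G].
    by rewrite mulnCA mulnC expnM; apply/mod_exp1/sqr1.
  have El : q ^ (2 * (kl * l)) = 1 %[mod G].
    by rewrite mulnCA mulnC expnM; apply/mod_exp1/sqr1.
  by rewrite -Ed E mulnDr muln1 expnD -modnMml El modnMml mul1n.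
have even2 k : ~~ odd k -> (G %| q ^ k + 1)%N -> (G %| 2)%N.
  move=> k_even; have -> : k = (2 * k./2)%N by lia.
  by rewrite expnM /dvdn -modnDml (mod_exp1 _ _ q2) modnDml.
have G2 : (G %| 2)%N.
  case: (boolP (odd d)) => d_odd; last exact: (even2 d).
  by apply: (even2 l) => //; lia.
have : (2 %| G)%N by rewrite dvdn_gcd !dvdn2 !oddD !oddX q_odd !orbT.
by move=> G2'; apply/eqP; rewrite eqn_dvd G2 G2'.
Qed.

(* Junk value: the identity when [g] is not a permutation. *)
Definition perm_of_fun (T : finType) (g : T -> T) : {perm T} :=
  odflt 1%g [pick s : {perm T} | [forall x, s x == g x]].

Lemma perm_of_funE (T : finType) (g : T -> T) :
  injective g -> perm_of_fun g =1 g.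
Proof.
move=> g_inj x; rewrite /perm_of_fun; case: pickP => [s /forallP/(_ x)/eqP //|].
by move/(_ (perm g_inj))/forallP=> []; move=> y; rewrite permE.
Qed.

(** Being fixed by conjugation means having (Qs - 1)-st power 1. Dividing by one solution [a0] makes
    the condition homogeneous, and the gcd turns the exponent Q + 1 into 2. *)
Lemma card_admissible (p N : nat) (F : finFieldType) (chF : p \in [pchar F])
    (s delta i : 'I_N.+2) (beta : F) (Q Qs : nat) :
    (forall x, frob chF s x = x ^+ Qs) ->
    (forall x, frob chF delta x = x ^+ Q) ->
    #|F| = (Qs * Qs)%N -> (1 < Qs)%N -> odd p -> odd Qs ->
    gcdn (Q + 1) (Qs + 1) = 2%N -> beta != 0 ->
  #|[set a | admissible chF s beta delta i a]| = (2 * (Qs - 1))%N.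
Proof.
move=> sE deltaE cardF Qs_gt1 p_odd Qs_odd gcdQ beta_neq0.
have unity x : x != 0 :> F -> x ^+ ((Qs + 1) * (Qs - 1)) = 1.
  move=> x_neq0; rewrite -[RHS](expf_card_pred x_neq0); congr (_ ^+ _).
  by rewrite cardF; nia.
(* The (Qs - 1)-st powers form a group of order Qs + 1, on which raising to the
   power [u] turns x^(Q+1) into x^2. *)
have [u [v uv]] : exists u v, (u * (Q + 1) = v * (Qs + 1) + 2)%N.
  have Q1 : (0 < Q + 1)%N by rewrite addn1.
  by case: (egcdnP (Qs + 1) Q1) => u v; rewrite gcdQ => E _; exists u, v.
have reduce (x : F) :
    x != 0 -> x ^+ (u * ((Q + 1) * (Qs - 1))) = x ^+ (2 * (Qs - 1)).
  move=> x_neq0; rewrite mulnA uv mulnDl exprD -mulnA [(v * _)%N]mulnC exprM.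
  by rewrite unity // expr1n mul1r.
have Qkill (x : F) :
    (x ^+ ((Q + 1) * (Qs - 1)) == 1) = (x ^+ (2 * (Qs - 1)) == 1).
  case: (eqVneq x 0) => [->|x_neq0]; first
    by rewrite !expr0n !muln_eq0 addn1 subn_eq0 leqNgt Qs_gt1.
  apply/eqP/eqP => [x1|x1]; first by rewrite -reduce // mulnC exprM x1 expr1n.
  have -> : ((Q + 1) * (Qs - 1) = (2 * (Qs - 1)) * ((Q + 1) %/ 2))%N.
    by rewrite mulnAC [(2 * (_ %/ _))%N]mulnC divnK // -{1}gcdQ dvdn_gcdl.
  by rewrite exprM x1 expr1n.
(* This is the exponent of [beta] in the element tested by [admissible]. *)
have [w wE] : exists w, (1 + Qs * p ^ i = 2 * w)%N.
  exists ((1 + Qs * p ^ i)./2); rewrite mul2n even_halfK //.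
  by rewrite oddD oddM oddX Qs_odd p_odd orbT.
(* On (Qs - 1)-st powers u(Q + 1) acts as 2, so [a0 ^+ (Q + 1)] cancels [beta ^+ (2 * w)] there. *)
pose a0 := (beta^-1) ^+ (w * u).
have a0_neq0 : a0 != 0 by rewrite expf_neq0 ?invr_neq0.
have admE c : admissible chF s beta delta i (a0 * c)
              = (c \in [set c | c ^+ (2 * (Qs - 1)) == 1]).
  rewrite inE /admissible mulf_eq0 (negPf a0_neq0) /=.
  case: (eqVneq c 0) => [->|c_neq0] /=; first
    by rewrite expr0n muln_eq0 subn_eq0 leqNgt Qs_gt1 eq_sym oner_eq0.
  rewrite -Qkill; set z := beta * _ * _.
  have z_neq0 : z != 0.
    by rewrite !mulf_neq0 ?fmorph_eq0 ?mulf_neq0 // fmorph_eq0.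
  have zE : z = beta ^+ (2 * w) * (a0 * c) ^+ (Q + 1).
    rewrite /z deltaE sE /frob -wE exprD expr1 exprM addn1 exprSr.
    by rewrite mulrAC.
  have -> : (frob chF s z == z) = (z ^+ (Qs - 1) == 1).
    rewrite sE -{1}(subnK (ltnW Qs_gt1)) addn1 exprSr -{3}[z]mul1r.
    exact: (inj_eq (mulIf z_neq0) _ 1).
  congr (_ == 1); rewrite zE exprMn -!exprM exprMn /a0 -exprM.
  have -> : (w * u * ((Q + 1) * (Qs - 1)) = u * ((Q + 1) * (Qs - 1)) * w)%N.
    by rewrite -mulnA mulnC.
  rewrite [X in _ * (X * _)]exprM reduce ?invr_neq0 // -exprM mulrA.
  have -> : (2 * w * (Qs - 1) = 2 * (Qs - 1) * w)%N by rewrite mulnAC.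
  by rewrite exprVn divff ?mul1r // expf_neq0.
have -> : [set a | admissible chF s beta delta i a]
    = [set a0 * c | c in [set c | c ^+ (2 * (Qs - 1)) == 1]].
  apply/setP=> a; rewrite inE; apply/idP/imsetP => [adm|[c cP ->]];
    last by rewrite admE.
  have aE : a = a0 * (a / a0) by rewrite mulrC divfK.
  by exists (a / a0) => //; rewrite -admE -aE.
rewrite (card_imset _ (mulfI a0_neq0)) card_unity_roots //; first by lia.
have -> : (#|F|.-1 = (Qs + 1) * (Qs - 1))%N by rewrite cardF; nia.
by rewrite dvdn_mul // dvdn2 oddD Qs_odd.
Qed.

(** * Translation to indices, isotopy criterion and group order *)

Theorem theorem3p1 (p h l d d' : nat) (F : finFieldType) (beta omega : F)
  (p_prime : prime p) (p_odd : odd p) (h_ge1 : (1 <= h)%N) (l_gt2 : (2 < l)%N)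
  (cardF : #|F| = ((p ^ h) ^ (2 * l))%N)
  (beta_nonsquare : ~ exists z : F, beta = z ^+ 2)
  (omega_neq0 : omega <> 0)
  (omega_conj : omega + omega ^+ ((p ^ h) ^ l) = 0)
  (d_bounds : (0 < d <= l - 1)%N) (d'_bounds : (0 < d' <= l - 1)%N)
  (gcd_ld : gcdn l d = 1%N) (gcd_ld' : gcdn l d' = 1%N)
  (odd_ld : odd (l + d)) (odd_ld' : odd (l + d')) :
  (strongly_isotopic p (BH (p ^ h) l beta omega d) (BH (p ^ h) l beta omega d')
     <-> d = d')
  /\ #|strong_autotopism_group p (BH (p ^ h) l beta omega d)|
     = (4 * l * h * ((p ^ h) ^ l - 1))%N.
Proof.
have [N nE] : exists N, (2 * l * h = N.+2)%N.
  exists (2 * l * h - 2)%N; nia.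
have cardF' : #|F| = (p ^ N.+2)%N.
  by rewrite cardF -expnM -nE; congr (_ ^ _)%N; lia.
have chF : p \in [pchar F] := card_finPcharP cardF' p_prime.
(* [c k] is the index of x |-> x^(q^k); since n = 2lh, it depends on k modulo 2l. *)
pose I := 'I_N.+2; pose c k : I := (h * k)%:R.
have cD j k : c j + c k = c (j + k)%N by rewrite /c mulnDr natrD.
have c_inj j k : (j < 2 * l)%N -> (k < 2 * l)%N -> c j = c k -> j = k.
  move=> j_lt k_lt /(congr1 (@nat_of_ord _)); rewrite /c !(@val_Zp_nat N.+2) //.
  rewrite !modn_small -?nE; nia.
have c_eq0 k : c k = 0 -> exists t, k = (2 * l * t)%N.
  move=> /(congr1 (@nat_of_ord _)); rewrite /c (@val_Zp_nat N.+2) //.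
  move=> /eqP /dvdnP[t E].
  by exists t; nia.
have c_neq0 k : (0 < k < 2 * l)%N -> c k != 0.
  move=> k_b; apply/eqP=> ck0; have := @c_inj k 0%N.
  by rewrite {2}/c muln0 => /(_ _ _ ck0); lia.
have frobE k x : frob chF (c k) x = x ^+ ((p ^ h) ^ k).
  by rewrite (frob_natr chF cardF') /frob expnM.
have two_neq0 : (2%:R : F) != 0.
  rewrite -(dvdn_pcharf chF) dvdn_prime2 //.
  by apply/eqP=> p2; rewrite p2 in p_odd.
have beta_neq0 : beta != 0.
  by apply/eqP=> b0; apply: beta_nonsquare; exists 0; rewrite b0 expr0n.
move/eqP: omega_neq0 => omega_neq0.
have omega_c : frob chF (c l) omega = - omega.
  by rewrite frobE; apply/eqP; rewrite -addr_eq0 addrC omega_conj.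
have BHE k x y : BH (p ^ h) l beta omega k x y
                 = bh chF (c l) beta omega (c k) x y.
  by rewrite /BH /bh /cross !frobE.
have ss : c l + c l = 0.
  apply: val_inj; rewrite cD /c /= (@val_Zp_nat N.+2) // -nE.
  by rewrite (_ : h * (l + l) = 2 * l * h)%N ?modnn //; lia.
have s_neq0 : c l != 0 by apply: c_neq0; lia.
have c_nondegenerate k : (0 < k <= l - 1)%N -> gcdn l k = 1%N -> odd (l + k) ->
  [/\ c k != 0, c k + c k != 0, c k != c l, c l + (c k + c k) != 0 &
      c l + (c k + (c k + c k)) != 0].
  move=> kb gk ok; rewrite !cD; split.
  - by apply: c_neq0; lia.
  - by apply: c_neq0; lia.
  - by apply/eqP=> /c_inj; lia.
  (* Here l = 2k, so coprimality gives k = 1 and l = 2, against l > 2. *)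
  - apply/eqP=> /c_eq0[t E].
    have t1 : t = 1%N by case: t E => [|[|t]]; nia.
    have E' : (l = 2 * k)%N by rewrite t1 in E; lia.
    by move: gk; rewrite E' gcdnC gcdnMl; lia.
  (* Here l divides 3k, hence 3, so l = 3 and parity forces k = 2; but 9 is not a multiple of 6. *)
  - apply/eqP=> /c_eq0[t E].
    have : (l %| k * 3)%N.
      by rewrite -(dvdn_addr _ (dvdnn l)); apply/dvdnP; exists (2 * t)%N; lia.
    rewrite Gauss_dvdr ?/coprime ?gk // => /(dvdn_leq (isT : (0 < 3)%N)) l_le3.
    have l3 : l = 3 by lia.
    have : (k = 2)%N by move: ok kb; rewrite l3; case: k {gk E} => [|[|[|]]].
    by move=> k2; move: E; rewrite l3 k2; lia.
have c_neq k : (0 < k <= l - 1)%N ->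
  [/\ c k != 0, c k != c l, c k != c l + c d, c k != - c d
    & c k = c d -> k = d].
  move=> kb; split.
  - by apply: c_neq0; lia.
  - by apply/eqP=> /c_inj; lia.
  - apply/eqP=> /(congr1 (+%R (c l))); rewrite addrA ss add0r cD => /c_inj.
    by lia.
  - by rewrite -addr_eq0 cD; apply: c_neq0; lia.
  by apply: c_inj; lia.
have [d_neq0 dd_neq0 d_neqs sdd_neq0 sddd_neq0] :=
  c_nondegenerate d d_bounds gcd_ld odd_ld.
(* Used with k = d' for the isotopy criterion and with k = d for the autotopisms. *)
have monomial k (M : {perm F}) (L : F -> F) : (0 < k <= l - 1)%N ->
    Fp_linear p M -> Fp_linear p L ->
    (forall x y, L (BH (p ^ h) l beta omega d x y)
                 = BH (p ^ h) l beta omega k (M x) (M y)) ->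
  k = d /\ exists i a,
    admissible chF (c l) beta (c d) i a /\ forall x, M x = a * frob chF i x.
Proof.
  move=> /c_neq[k_neq0 k_neqs k_neqsd k_neqNd k_inj].
  move=> ML LL LM; have [m mE] := Fp_linear_repr chF cardF' ML.
  have LM' x y : L (bh chF (c l) beta omega (c d) x y)
      = bh chF (c l) beta omega (c k)
          (\sum_i m i * frob chF i x) (\sum_i m i * frob chF i y).
    by rewrite -!BHE LM !mE.
  have m_ex : exists i, m i != 0.
    apply/existsP; apply: contraT; rewrite negb_exists => /forallP m0.
    have M0 x : M x = 0.
      rewrite mE big1 // => i _; move: (m0 i); rewrite negbK => /eqP->.
      by rewrite mul0r.
    have /perm_inj/eqP : M 1 = M 0 by rewrite !M0.
    by rewrite oner_eq0.
  have [kd [i mi m0]] := isotopism_monomial cardF' s_neq0 ss beta_neq0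
    omega_neq0 omega_c two_neq0 LL LM' d_neq0 dd_neq0 d_neqs sdd_neq0 sddd_neq0
    k_neq0 k_neqs k_neqsd k_neqNd m_ex.
  split; first exact: k_inj.
  exists i, (m i); split.
    rewrite /admissible mi; apply/eqP.
    by apply: (isotopism_monomial_real cardF' s_neq0 ss omega_neq0 omega_c two_neq0
      LL LM' d_neq0 dd_neq0 d_neqs).
  move=> x; rewrite mE (bigD1 i) //= big1 ?addr0 // => j ji.
  by rewrite m0 // mul0r.
split.
  split=> [[[[M M'] L]]|<-].
    case/andP=> /and4P[ML _ LL /forallP H] /eqP /= MM'; subst M'.
    have [|//] := monomial d' M L d'_bounds ML LL.
    by move=> x y; have /forallP/(_ y)/eqP := H x.
  exists (1, 1, 1)%g; rewrite /strong_isotopism /= !Fp_linear_id eqxx /= andbT.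
  by apply/forallP=> x; apply/forallP=> y; rewrite !perm1.
pose adm := admissible chF (c l) beta (c d).
(* [T] parametrizes the autotopisms by the exponent and the coefficient of their monomial. *)
pose T := [set u : I * F | adm u.1 u.2].
pose Mf (u : I * F) x := u.2 * frob chF u.1 x.
pose Lf (u : I * F) := autotopism_image chF (c l) beta omega (c d) u.1 u.2.
pose f u := (perm_of_fun (Mf u), perm_of_fun (Mf u), perm_of_fun (Lf u)).
have Mf_inj u : u \in T -> injective (Mf u).
  rewrite inE => /andP[a_neq0 _] x y /(mulfI a_neq0); exact: fmorph_inj.
have Lf_inj u : u \in T -> injective (Lf u).
  by rewrite inE => admu; apply: autotopism_image_inj.
have Lf_lin u : Fp_linear p (Lf u).
  exact: (autotopism_image_Fp_linear _ _ _ _ two_neq0).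
have autE : strong_autotopisms p (BH (p ^ h) l beta omega d) = f @: T.
  apply/setP=> -[[M M'] L]; apply/idP/imsetP.
    rewrite inE => /andP[/and4P[ML _ LL /forallP H] /eqP /= MM']; subst M'.
    have LM x y : L (BH (p ^ h) l beta omega d x y)
                  = BH (p ^ h) l beta omega d (M x) (M y).
      by have /forallP/(_ y)/eqP := H x.
    have [_ [i [a [adm_ia ME]]]] := monomial d M L d_bounds ML LL LM.
    have uT : (i, a) \in T by rewrite inE.
    exists (i, a) => //; rewrite /f; congr (_, _, _); apply/permP=> x.
    - by rewrite perm_of_funE ?ME //; exact: Mf_inj.
    - by rewrite perm_of_funE ?ME //; exact: Mf_inj.
    rewrite perm_of_funE; last exact: Lf_inj.
    move: x; apply: (Fp_linear_bh_inj cardF' ss beta_neq0 omega_neq0 omega_c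
      two_neq0 d_neqs dd_neq0 LL (Lf_lin (i, a))) => x y.
    rewrite -BHE LM !ME !BHE.
    by rewrite -(autotopism_imageE cardF' ss beta_neq0 omega_neq0 omega_c
                   two_neq0 adm_ia).
  case=> u uT [-> -> ->]; have ME := perm_of_funE (Mf_inj u uT).
  have LE := perm_of_funE (Lf_inj u uT).
  have M_lin : Fp_linear p (perm_of_fun (Mf u)).
    apply/forallP=> b; apply/forallP=> x; apply/forallP=> y; rewrite !ME /Mf.
    by rewrite rmorphD rmorphM rmorph_nat mulrDr mulrCA.
  have L_lin : Fp_linear p (perm_of_fun (Lf u)).
    have /forallP LfL := Lf_lin u.
    apply/forallP=> b; apply/forallP=> x; apply/forallP=> y; rewrite !LE /Lf.
    by have /forallP/(_ x)/forallP := LfL b; apply.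
  rewrite inE /strong_isotopism /= M_lin L_lin eqxx andbT /=.
  apply/forallP=> x; apply/forallP=> y; rewrite !ME LE !BHE /Mf.
  by apply/eqP/autotopism_imageE => //; move: uT; rewrite inE.
rewrite /= autE card_in_imset; last first.
  move=> u v uT vT [/permP eqM _]; have {}eqM x : Mf u x = Mf v x.
    by have := eqM x; rewrite !perm_of_funE //; exact: Mf_inj.
  have eq2 : u.2 = v.2 by have := eqM 1; rewrite /Mf !rmorph1 !mulr1.
  have u2_neq0 : u.2 != 0 by move: uT; rewrite inE => /andP[].
  suff eq1 : u.1 = v.1.
    by case: u v eq1 eq2 {uT vT eqM u2_neq0} => [? ?] [? ?] /= -> ->.
  apply/eqP; apply: contraT => neq_uv.
  (* With distinct exponents, the difference of the two equal monomials would vanish on F despite a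
     nonzero coefficient. *)
  pose m (k : I) :=
    (if k == u.1 then u.2 else 0) - (if k == v.1 then v.2 else 0).
  have pick1 (i : I) (a x : F) :
      \sum_k (if k == i then a else 0) * frob chF k x = a * frob chF i x.
    rewrite (bigD1 i) //= eqxx big1 ?addr0 // => k /negPf->.
    by rewrite mul0r.
  have m0 x : \sum_k m k * frob chF k x = 0.
    rewrite -[RHS](subrr (Mf u x)) {2}eqM /Mf -!pick1 -sumrB.
    by apply: eq_bigr => k _; rewrite mulrBl.
  have := linpoly_eq0 cardF' m0 u.1; rewrite /m eqxx (negPf neq_uv) subr0 => u20.
  by rewrite u20 eqxx in u2_neq0.
have cardT : #|T| = \sum_(i : I) #|[set a | adm i a]|.
  rewrite -sum1dep_card -(pair_big_dep xpredT adm (fun _ _ => 1%N)) /=.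
  by apply: eq_bigr => i _; rewrite sum1dep_card.
have q_gt1 : (1 < p ^ h)%N by rewrite -(exp1n h) ltn_exp2r ?prime_gt1.
have q_odd k : odd ((p ^ h) ^ k) by rewrite !oddX p_odd !orbT.
have card_adm i : #|[set a | adm i a]| = (2 * ((p ^ h) ^ l - 1))%N.
  apply: (@card_admissible _ _ _ _ _ _ _ _ ((p ^ h) ^ d)) => //.
  - by rewrite cardF mulnC expnM mulnn.
  - by rewrite -(exp1n l) ltn_exp2r // ltnW // ltnW.
  apply: gcdn_expn_add1 => //; first by case/andP: d_bounds.
  by rewrite oddX p_odd orbT.
rewrite cardT (eq_bigr _ (fun i _ => card_adm i)) sum_nat_const card_ord -nE.
by rewrite mulnA; congr (_ * _)%N; rewrite mulnC !mulnA.
Qed.
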